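(* Let $R$ be a ring which is left noetherian and right coherent and has finite left pure global dimension. Then $\mathsf{K}(\mathsf{Add}(\mathsf{sub}(\mathsf{Flat}\,R)))$ is compactly generated.
   Context: Modules are left $R$-modules. $\mathsf{Flat}\,R$ is the class of flat modules and $\mathsf{mod}\,R$ the class of finitely presented modules. For a class $\mathbb{A}$ of modules, $\mathsf{sub}\,\mathbb{A}=\{S\in\mathsf{mod}\,R\mid S\subseteq A\text{ for some }A\in\mathbb{A}\}$, and $\mathsf{Add}\,\mathbb{A}$ is the class of modules isomorphic to a direct summand of a coproduct $\coprod_{i\in I}A_i$ with $A_i\in\mathbb{A}$, $I$ an arbitrary set. For a class $\mathbb{X}=\mathsf{Add}\,\mathbb{X}$, $\mathsf{K}(\mathbb{X})$ is the triangulated category with objects the ($\mathbb{Z}$-indexed) chain complexes of modules from $\mathbb{X}$ and morphisms the chain maps modulo homotopy. A triangulated category $\mathsf{T}$ with set-indexed coproducts is compactly generated if there is a set $\mathcal{G}$ of compact objects (objects $C$ for which $\coprod_i\operatorname{Hom}_{\mathsf T}(C,X_i)\to\operatorname{Hom}_{\mathsf T}(C,\coprod_iX_i)$ is always an isomorphism) such that, for all $X\in\mathsf{T}$, $\operatorname{Hom}_{\mathsf T}(G,X)=0$ for all $G\in\mathcal{G}$ implies $X\cong0$. A sequence $Y$ of modules is pure exact if $\operatorname{Hom}_R(N,Y)$ is exact for every finitely presented module $N$. A module $P$ is pure projective if $\operatorname{Hom}_R(P,-)$ preserves exactness of pure exact sequences. The left pure global dimension of $R$ is the least $d$ (or $\infty$)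 such that every left module $N$ has a pure exact sequence $0\to P_d\to\cdots\to P_0\to N\to0$ with all $P_i$ pure projective. *)

(* Defs.v *)
From HB Require Import structures.
From mathcomp Require Import all_boot all_order all_algebra.

Set Implicit Arguments.
Unset Strict Implicit.
Unset Printing Implicit Defensive.

Import GRing.Theory.
Local Open Scope ring_scope.

(* Set-sized index types: the universe level is exactly the one of carriers
   of modules, hence strictly below the level of [lmodType R] itself.  A
   family indexed by such a type is indexed by a set, and not by a proper
   class such as the class of all modules or of all complexes. *)
Notation smallType := Type@{GRing.Lmodule.axioms_.u0} (only parsing).

Definition modClass (R : pzRingType) := lmodType R -> Prop.

Section Modules.
Variable R : pzRingType.
Implicit Types M N P A B C : lmodType R.

Definition surjective (T U : Type) (f : T -> U) := forall y, exists x, f x = y.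

Definition exact_at (A B C : Type) (zero : C) (f : A -> B) (g : B -> C) :=
  forall y, g y = zero <-> exists x, f x = y.

Definition fin_generated M :=
  exists (n : nat) (f : {linear 'rV[R]_n -> M}), surjective f.

Definition fin_presented : modClass R := fun M =>
  exists (m n : nat) (g : {linear 'rV[R]_m -> 'rV[R]_n})
         (f : {linear 'rV[R]_n -> M}),
    surjective f /\ exact_at 0 g f.

(* A left ideal is presented as a module [I] with a monomorphism to R. *)
Definition left_noetherian :=
  forall (I : lmodType R) (j : {linear I -> R^o}),
    injective j -> fin_generated I.

Definition left_coherent :=
  forall (I : lmodType R) (j : {linear I -> R^o}),
    injective j -> fin_generated I -> fin_presented I.

(* Right modules are left modules over the converse ring R^c, so that
   [r *: a] stands for a r when [A : lmodType R^c]. *)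
Definition balanced (A : lmodType R^c) (F : lmodType R) (W : zmodType)
    (b : A -> F -> W) :=
  [/\ forall a a' x, b (a + a') x = b a x + b a' x,
      forall a x x', b a (x + x') = b a x + b a x'
    & forall (r : R) a x, b ((r : R^c) *: a) x = b a (r *: x)].

Definition is_tensor (A : lmodType R^c) (F : lmodType R) (T : zmodType)
    (t : A -> F -> T) :=
  balanced t /\
  forall (W : zmodType) (b : A -> F -> W), balanced b ->
    (exists u : {additive T -> W}, forall a x, u (t a x) = b a x) /\
    (forall u v : {additive T -> W},
       (forall a x, u (t a x) = b a x) -> (forall a x, v (t a x) = b a x) ->
       u =1 v).

Definition flat : modClass R := fun F =>
  forall (A B : lmodType R^c) (f : {linear A -> B}), injective f ->
  forall (TA TB : zmodType) (tA : A -> F -> TA) (tB : B -> F -> TB),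
    is_tensor tA -> is_tensor tB ->
  forall fF : {additive TA -> TB},
    (forall a x, fF (tA a x) = tB (f a) x) -> injective fF.

Definition sub (X : modClass R) : modClass R := fun S =>
  fin_presented S /\
  exists2 A : lmodType R, X A & exists j : {linear S -> A}, injective j.

Definition is_mod_coproduct (I : smallType) (A : I -> lmodType R)
    (C : lmodType R) (inj : forall i, {linear A i -> C}) :=
  forall (N : lmodType R) (f : forall i, {linear A i -> N}),
    (exists u : {linear C -> N}, forall i x, u (inj i x) = f i x) /\
    (forall u v : {linear C -> N},
       (forall i x, u (inj i x) = f i x) -> (forall i x, v (inj i x) = f i x) ->
       u =1 v).

Definition Add (X : modClass R) : modClass R := fun M =>
  exists (I : smallType) (A : I -> lmodType R) (C : lmodType R)
         (inj : forall i, {linear A i -> C}),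
    [/\ forall i, X (A i), is_mod_coproduct inj
      & exists (s : {linear M -> C}) (r : {linear C -> M}), cancel s r].

(* Exactness of Hom(N, A) -> Hom(N, B) -> Hom(N, C). *)
Definition hom_exact N A B C (f : {linear A -> B}) (g : {linear B -> C}) :=
  forall h : {linear N -> B},
    (forall x, g (h x) = 0) <->
    (exists k : {linear N -> A}, forall x, f (k x) = h x).

(* A longer sequence is pure exact when each of its consecutive pairs of
   maps is. *)
Definition pure_exact A B C (f : {linear A -> B}) (g : {linear B -> C}) :=
  forall N, fin_presented N -> hom_exact N f g.

Definition pure_projective : modClass R := fun P =>
  forall A B C (f : {linear A -> B}) (g : {linear B -> C}),
    pure_exact f g -> hom_exact P f g.

(* 0 -> P_d -> ... -> P_0 -> N -> 0, continued on the left by zero modules. *)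
Definition pure_proj_resolution (d : nat) N :=
  exists (P : nat -> lmodType R) (del : forall i, {linear P i.+1 -> P i})
         (aug : {linear P 0%N -> N}),
    [/\ forall i, pure_projective (P i),
        forall i, (d < i)%N -> forall x : P i, x = 0,
        pure_exact aug (\0 : {linear N -> 'rV[R]_0}),
        pure_exact (del 0%N) aug
      & forall i, pure_exact (del i.+1) (del i)].

Definition finite_left_pure_gldim :=
  exists d : nat, forall N, pure_proj_resolution d N.

End Modules.

Definition right_coherent (R : pzRingType) := left_coherent R^c.

Section HomotopyCategory.
Variables (R : pzRingType) (X : modClass R).

(* As n ranges over int, so does n + 1: the differential into degree n is
   indexed by n, and its source is in degree n + 1. *)
Record complex := Complex {
  cobj :> int -> lmodType R;
  cdiff : forall n, {linear cobj (n + 1) -> cobj n};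
  cobjP : forall n, X (cobj n);
  cdiffK : forall n x, cdiff n (cdiff (n + 1) x) = 0 }.

Record chain_map (C D : complex) := ChainMap {
  cmap :> forall n, {linear C n -> D n};
  cmapP : forall n x, cmap n (cdiff C n x) = cdiff D n (cmap (n + 1) x) }.

Section Operations.
Variables C D E : complex.

Fact chain_zeroP n (x : C (n + 1)) :
  (\0 : {linear C n -> D n}) (cdiff C n x) =
  cdiff D n ((\0 : {linear C (n + 1) -> D (n + 1)}) x).
Proof. by rewrite /= linear0. Qed.

Definition chain_zero : chain_map C D := ChainMap chain_zeroP.

Fact chain_addP (f g : chain_map C D) n (x : C (n + 1)) :
  (f n \+ g n : {linear C n -> D n}) (cdiff C n x) =
  cdiff D n ((f (n + 1) \+ g (n + 1) : {linear _ -> _}) x).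
Proof. by rewrite /= linearD !cmapP. Qed.

Definition chain_add f g : chain_map C D := ChainMap (chain_addP f g).

Fact chain_compP (g : chain_map D E) (f : chain_map C D) n (x : C (n + 1)) :
  (g n \o f n : {linear C n -> E n}) (cdiff C n x) =
  cdiff E n ((g (n + 1) \o f (n + 1) : {linear _ -> _}) x).
Proof. by rewrite /= !cmapP. Qed.

Definition chain_comp g f : chain_map C E := ChainMap (chain_compP g f).

End Operations.

(* Equality of morphisms of K(X): f - g = d s + s d, stated in degree n + 1. *)
Definition homotopic (C D : complex) (f g : chain_map C D) :=
  exists s : forall n, {linear C n -> D (n + 1)},
    forall n (x : C (n + 1)),
      f (n + 1) x - g (n + 1) x =
        cdiff D (n + 1) (s (n + 1) x) + s n (cdiff C n x).

Definition null_homotopic (C D : complex) (f : chain_map C D) :=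
  homotopic f (chain_zero C D).

Definition zero_object (C : complex) :=
  forall Z : complex,
    (forall f : chain_map C Z, null_homotopic f) /\
    (forall f : chain_map Z C, null_homotopic f).

(* Coproducts in K(X), by their universal property. *)
Definition is_coproduct (I : smallType) (D : I -> complex) (Y : complex)
    (inj : forall i, chain_map (D i) Y) :=
  forall (Z : complex) (f : forall i, chain_map (D i) Z),
    (exists u : chain_map Y Z,
       forall i, homotopic (chain_comp u (inj i)) (f i)) /\
    (forall u v : chain_map Y Z,
       (forall i, homotopic (chain_comp u (inj i)) (f i)) ->
       (forall i, homotopic (chain_comp v (inj i)) (f i)) ->
       homotopic u v).

Definition has_coproducts :=
  forall (I : smallType) (D : I -> complex),
    exists (Y : complex) (inj : forall i, chain_map (D i) Y), is_coproduct inj.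

(* The value of the canonical map from the direct sum of the Hom(C, D_i) to
   Hom(C, Y) on the element with components g_k : C -> D_(e_k) at finitely
   many pairwise distinct indices e_k, all other components being zero. *)
Definition sum_map (I : smallType) (D : I -> complex) (C Y : complex)
    (inj : forall i, chain_map (D i) Y) (m : nat) (e : 'I_m -> I)
    (g : forall k, chain_map C (D (e k))) : chain_map C Y :=
  \big[@chain_add C Y/chain_zero C Y]_(k < m) chain_comp (inj (e k)) (g k).

(* The canonical map is onto and has trivial kernel. *)
Definition compact (C : complex) :=
  forall (I : smallType) (D : I -> complex) (Y : complex)
         (inj : forall i, chain_map (D i) Y), is_coproduct inj ->
    (forall f : chain_map C Y,
       exists (m : nat) (e : 'I_m -> I) (g : forall k, chain_map C (D (e k))),
         injective e /\ homotopic (sum_map inj g) f) /\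
    (forall (m : nat) (e : 'I_m -> I) (g : forall k, chain_map C (D (e k))),
       injective e -> null_homotopic (sum_map inj g) ->
       forall k, null_homotopic (g k)).

Definition K_compactly_generated :=
  has_coproducts /\
  exists (S : smallType) (G : S -> complex),
    (forall s, compact (G s)) /\
    forall C : complex,
      (forall s (f : chain_map (G s) C), null_homotopic f) -> zero_object C.

End HomotopyCategory.

(* Main.v *)
Require Import Defs.
From HB Require Import structures.
From mathcomp Require Import all_boot all_order all_algebra.
From mathcomp Require Import generic_quotient ring_quotient boolp.

Set Implicit Arguments.
Unset Strict Implicit.
Unset Printing Implicit Defensive.

Import GRing.Theory.
Local Open Scope ring_scope.

(** Write X for Add (sub Flat).  The compact generators are the stalk complexes
    S[n] of the finitely generated submodules S of the free modules R^k, in all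
    degrees n; up to isomorphism there is only a set of them, since S is the
    row space of a matrix.

    Why S[n] is an object of K(X): R^k is flat ([free_flat]) and S is finitely
    presented because R is left noetherian ([noetherian_fin_presented]).

    Why S[n] is compact ([stalk_compact]): a map from S[n] to a complex is a
    map from S to the cycles of degree n, coproducts in K(X) are computed
    degreewise, and a map from a finitely generated module to a direct sum
    takes its values in a finite subsum.

    Why they generate.  Suppose that all maps from the S[n] to a complex C of
    K(X) are null-homotopic, so that Hom(S, C) is exact for each such S.

    - Every finitely presented N maps onto some S in such a way that all maps
      from N to modules in X factor through it ([sub_flat_reflection]).  By the
      equational criterion of flatness ([flat_equations]), a map from N to a
      flat module is a combination of functionals N -> R.  The functionals form
      the kernel of a map between free right modules of finite rank, hence are
      finitely generated as R is right coherent ([coherent_ker]), say by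
      f_1, ..., f_k; then S is the image of (f_1, ..., f_k) : N -> R^k.  It
      follows that Hom(N, C) is exact for all finitely presented N.

    - The modules in X are pure projective ([Add_pure_projective]), so C is
      an acyclic complex of projectives for the pure exact structure.
      Its boundaries B_n sit in pure exact sequences
      0 -> B_(n+1) -> C_(n+1) -> B_n -> 0, so B_(n+d) is a d-th syzygy of B_n,
      and dimension shifting shows that it is pure projective when d exceeds
      the pure global dimension ([boundaries_pure_projective]).  The sequences
      therefore split, and C is contractible
      ([pure_acyclic_contraction]). *)

(** * Linear maps and submodules *)

Lemma dchoice (I : Type) (T : I -> Type) (P : forall i, T i -> Prop) :
  (forall i, exists x, P i x) -> exists f : forall i, T i, forall i, P i (f i).
Proof.
move=> h; exists (fun i => sval (cid (h i))) => i; exact: (svalP (cid (h i))).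
Qed.

Section Linear.
Variable R : pzRingType.
Implicit Types U V W : lmodType R.

Definition mklin U V (f : U -> V) (fL : linear f) : {linear U -> V} :=
  HB.pack f (GRing.isLinear.Build R U V *:%R f fL).

Lemma lin_lift_inj U V W (j : {linear W -> V}) (f : {linear U -> V}) :
  injective j -> (forall u, exists x, j x = f u) ->
  exists g : {linear U -> W}, forall u, j (g u) = f u.
Proof.
move=> jI /choice[g gP].
have gL : linear g by move=> a u v; apply: jI; rewrite linearP !gP linearP.
by exists (mklin gL).
Qed.

Lemma lin_factor U V W (p : {linear U -> W}) (f : {linear U -> V}) :
  surjective p -> (forall u, p u = 0 -> f u = 0) ->
  exists g : {linear W -> V}, forall u, g (p u) = f u.
Proof.
move=> /choice[s sP] f0.
have fs u : f (s (p u)) = f u.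
  by apply/subr0_eq; rewrite -linearB f0 // linearB /= sP subrr.
have gL : linear (fun w => f (s w)).
  move=> a w w'; rewrite -{1}(sP w) -{1}(sP w') -linearP fs linearP.
  by rewrite -[w]sP -[w']sP !fs.
by exists (mklin gL).
Qed.

Lemma free_lin n V (x : 'I_n -> V) :
  exists f : {linear 'rV[R]_n -> V}, forall v, f v = \sum_i v 0 i *: x i.
Proof.
have fL : linear (fun v : 'rV[R]_n => \sum_i v 0 i *: x i).
  move=> a u v; rewrite scaler_sumr -big_split; apply: eq_bigr => i _ /=.
  by rewrite !mxE scalerDl scalerA.
by exists (mklin fL).
Qed.

Lemma free_linE n V (f : {linear 'rV[R]_n -> V}) v :
  f v = \sum_i v 0 i *: f (delta_mx 0 i).
Proof.
rewrite {1}(row_sum_delta v) linear_sum.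
by apply: eq_bigr => i _; rewrite linearZ.
Qed.

Lemma free_lift n V W (p : {linear V -> W}) (f : {linear 'rV[R]_n -> W}) :
  (forall v, exists x, p x = f v) ->
  exists g : {linear 'rV[R]_n -> V}, forall v, p (g v) = f v.
Proof.
move=> fp.
have [s sP] := choice (fun i => fp (delta_mx 0 i)).
have [g gE] := free_lin s; exists g => v.
rewrite gE linear_sum [RHS]free_linE; apply: eq_bigr => i _.
by rewrite linearZ /= sP.
Qed.

End Linear.

Definition submodule (R : pzRingType) (V : lmodType R) (P : V -> Prop) :=
  P 0 /\ forall a u v, P u -> P v -> P (a *: u + v).

Section Submodule.
Variables (R : pzRingType) (V : lmodType R) (P : V -> Prop).

(** The predicate carries the proof of closure, so that the module structure
    below can be inferred from it. *)
Definition submod_pred (_ : submodule P) : {pred V} := fun x => `[<P x>].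

Variable hP : submodule P.

Fact submod_pred_closed : subsemimod_closed (submod_pred hP).
Proof.
case: hP => P0 PL; split; first split.
- exact/asboolP.
- move=> u v /asboolP Pu /asboolP Pv; apply/asboolP.
  by rewrite -[u]scale1r; apply: PL.
- move=> a u /asboolP Pu; apply/asboolP.
  by rewrite -[_ *: _]addr0; apply: PL.
Qed.

HB.instance Definition _ :=
  GRing.isSubmodClosed.Build R V (submod_pred hP) submod_pred_closed.

Record submod_type := Submod { submod_val : V; _ : submod_val \in submod_pred hP }.

HB.instance Definition _ := [isSub for submod_val].
HB.instance Definition _ := [Choice of submod_type by <:].
HB.instance Definition _ := [SubChoice_isSubLmodule of submod_type by <:].

End Submodule.

Section Images.
Variable R : pzRingType.
Implicit Types U V W : lmodType R.

(** A submodule is handled through its inclusion map only, which keeps the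
    carrier abstract. *)
Lemma submod_ex V (P : V -> Prop) : submodule P ->
  exists (S : lmodType R) (j : {linear S -> V}),
    injective j /\ forall v, P v <-> exists x, j x = v.
Proof.
move=> hP; exists (submod_type hP), (\val : {linear submod_type hP -> V}).
split=> [|v]; first exact: val_inj.
split=> [Pv|[x <-]]; last exact/asboolP/(valP x).
by exists (@Submod _ _ _ hP v (asboolT Pv)).
Qed.

Lemma image_submod U V (f : {linear U -> V}) :
  submodule (fun v => exists x, f x = v).
Proof.
split=> [|a _ _ [u <-] [v <-]]; first by exists 0; rewrite linear0.
by exists (a *: u + v); rewrite linearP.
Qed.

Lemma ker_submod U V (f : {linear U -> V}) : submodule (fun u => f u = 0).
Proof.
split=> [|a u v fu fv]; first by rewrite linear0.
by rewrite linearP fu fv scaler0 addr0.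
Qed.

Lemma image_ex U V (f : {linear U -> V}) :
  exists (S : lmodType R) (p : {linear U -> S}) (j : {linear S -> V}),
    [/\ surjective p, injective j & forall u, j (p u) = f u].
Proof.
have [S [j [jI jP]]] := submod_ex (image_submod f).
have [|p pP] := lin_lift_inj (f := f) jI.
  by move=> u; apply/jP; exists u.
exists S, p, j; split=> // s.
have /jP[u fu] : exists x, j x = j s by exists s.
by exists u; apply: jI; rewrite pP.
Qed.

End Images.

(** * Kernels between free modules over noetherian and coherent rings *)

Section Finiteness.
Variable R : pzRingType.
Implicit Types M N : lmodType R.

Lemma free_sum p q M (f : {linear 'rV[R]_p -> M}) (g : {linear 'rV[R]_q -> M}) :
  exists h : {linear 'rV[R]_(p + q) -> M},
    forall y, (exists x, h x = y) <-> exists x z, f x + g z = y.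
Proof.
have hL : linear (fun x : 'rV[R]_(p + q) => f (lsubmx x) + g (rsubmx x)).
  by move=> a u v; rewrite !linearP /= scalerDr addrACA.
exists (mklin hL) => y; split=> [[x <-]|[x [z <-]]].
  by exists (lsubmx x), (rsubmx x).
by exists (row_mx x z); rewrite /= row_mxKl row_mxKr.
Qed.

Lemma row_coord_linear n i : linear (fun v : 'rV[R]_n => v 0 i : R^o).
Proof. by move=> a u v; rewrite !mxE. Qed.

Definition row_coord n i : {linear 'rV[R]_n -> R^o} := mklin (@row_coord_linear n i).

Lemma row_mx0_linear n : linear (fun v : 'rV[R]_n => row_mx (0 : 'rV[R]_1) v).
Proof.
by move=> a u v; rewrite scale_row_mx add_row_mx scaler0 addr0.
Qed.

(** Induction on the rank: the first coordinates of the elements of P form a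
    left ideal, generated by finitely many of them; what remains is the part
    of P with first coordinate zero, a submodule of a free module of smaller
    rank. *)
Lemma noetherian_submodule n (P : 'rV[R]_n -> Prop) :
  left_noetherian R -> submodule P ->
  exists (m : nat) (f : {linear 'rV[R]_m -> 'rV[R]_n}),
    forall v, P v <-> exists x, f x = v.
Proof.
move=> nR; elim: n P => [|n IHn] P hP.
  exists 0%N, \0 => v; split=> _; last by rewrite [v]thinmx0; case: hP.
  by exists 0; rewrite [v]thinmx0.
have [S [j [jI jP]]] := submod_ex hP.
pose c : {linear S -> R^o} := row_coord ord0 \o j.
have [I [i [iI iP]]] := submod_ex (image_submod c).
have [p [phi phiS]] := nR I i iI.
have [g gP] : exists g : {linear 'rV[R]_p -> S}, forall v, c (g v) = i (phi v).
  apply: (free_lift (p := c) (f := i \o phi)) => v.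
  by apply/iP; exists (phi v).
pose Q (w : 'rV[R]_n) := P (row_mx (0 : 'rV[R]_1) w).
have hQ : submodule Q.
  case: hP => P0 PL; split=> [|a u v Pu Pv]; first by rewrite /Q row_mx0.
  by rewrite /Q row_mx0_linear; apply: PL.
have [q [psi psiP]] := IHn Q hQ.
have [f fP] := free_sum (j \o g) (mklin (@row_mx0_linear n) \o psi).
exists (p + q)%N, f => v; split=> [Pv|/fP[x [z /= <-]]].
  have [s sv] := (jP v).1 Pv.
  have [r ri] := (iP (c s)).1 (ex_intro _ s erefl).
  have [x xr] := phiS r.
  have Pgx : P (j (g x)) by apply/jP; exists (g x).
  have Pd : P (v - j (g x)).
    by rewrite addrC -scaleN1r; apply: (hP.2).
  have dE : v - j (g x) = row_mx (0 : 'rV[R]_1) (rsubmx (v - j (g x) : 'rV_(1 + n))).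
    rewrite -[LHS](hsubmxK (v - j (g x) : 'rV_(1 + n))).
    suff -> : lsubmx (v - j (g x) : 'rV_(1 + n)) = 0 by [].
    apply/rowP=> k; rewrite !mxE (_ : lshift n k = ord0); last first.
      by apply/val_inj; rewrite /= ord1.
    by have := gP x; rewrite xr ri /c /= => ->; rewrite sv subrr.
  rewrite dE in Pd; have [z zP] := (psiP _).1 Pd.
  by apply/fP; exists x, z; rewrite /= zP -dE addrC subrK.
rewrite -[j _]scale1r; apply: hP.2; first by apply/jP; exists (g x).
by apply/psiP; exists z.
Qed.

Lemma noetherian_fin_presented M :
  left_noetherian R -> fin_generated M -> fin_presented M.
Proof.
move=> nR [n [f fS]].
have [m [g gP]] := noetherian_submodule nR (ker_submod f).
by exists m, n, g, f.
Qed.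

(** Schanuel's argument.  Compare f with a presentation b : R^q -> M whose
    kernel is the image of a, by lifts al of f along b and be of b along f.
    If f y = 0 then al y lies in the image of a, and
    y = (y - be (al y)) + be (al y); conversely both kinds of summands
    are killed by f. *)
Lemma fin_presented_ker n M (f : {linear 'rV[R]_n -> M}) :
  fin_presented M -> surjective f ->
  exists (k : nat) (c : {linear 'rV[R]_k -> 'rV[R]_n}), exact_at 0 c f.
Proof.
move=> [p [q [a [b [bS abE]]]]] fS.
have [al alP] := free_lift (p := b) (f := f) (fun v => bS (f v)).
have [be beP] := free_lift (p := f) (f := b) (fun v => fS (b v)).
have hL : linear (fun v => v - be (al v)).
  by move=> t u v; rewrite !linearP /= scalerDr addrACA.
have [c cP] := free_sum (mklin hL) (be \o a).
exists (n + p)%N, c => y; split=> [fy|/cP[x [z /= <-]]].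
  have [w wP] : exists w, a w = al y by apply/abE; rewrite alP.
  by apply/cP; exists y, w; rewrite /= wP subrK.
have az : b (a z) = 0 by apply/abE; exists z.
by rewrite linearD linearB /= !beP alP subrr az addr0.
Qed.

(** Induction on the number of functionals: once the common kernel of all but
    one is parametrized by c : R^k -> R^n, the last one restricts to a
    functional on R^k, whose image is a finitely generated left ideal, hence
    finitely presented. *)
Lemma coherent_functionals n m (f : 'I_m -> {linear 'rV[R]_n -> R^o}) :
  left_coherent R ->
  exists (k : nat) (c : {linear 'rV[R]_k -> 'rV[R]_n}),
    forall v, (forall i, f i v = 0) <-> exists x, c x = v.
Proof.
move=> cR; elim: m f => [|m IHm] f.
  exists n, idfun => v; split=> [_|_ []//]; by exists v.
have [k [c cP]] := IHm (fun i => f (lift ord0 i)).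
have [I [p [j [pS jI pjE]]]] := image_ex (f ord0 \o c).
have Ifp : fin_presented I.
  by apply: cR jI _; exists k, p.
have [l [d dP]] := fin_presented_ker Ifp pS.
exists l, (c \o d) => v; split=> [fv|[x <-] i].
  have [w wv] := (cP v).1 (fun i => fv (lift ord0 i)).
  have [x xw] : exists x, d x = w.
    by apply/dP; apply: jI; rewrite pjE /= wv fv linear0.
  by exists x; rewrite /= xw.
case: (unliftP ord0 i) => [k' ->|->].
  by move: k'; apply/cP; exists (d x).
have : p (d x) = 0 by apply/dP; exists x.
by move/(congr1 j); rewrite pjE linear0.
Qed.

Lemma coherent_ker n m (f : {linear 'rV[R]_n -> 'rV[R]_m}) :
  left_coherent R ->
  exists (k : nat) (c : {linear 'rV[R]_k -> 'rV[R]_n}), exact_at 0 c f.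
Proof.
move=> cR.
have [k [c cP]] := coherent_functionals (fun i => row_coord i \o f) cR.
exists k, c => v; rewrite -cP; split=> [fv i|fv]; first by rewrite /= fv mxE.
by apply/rowP => i; rewrite mxE; apply: fv.
Qed.

End Finiteness.

(** * The equational criterion of flatness, and flatness of free modules *)

Section Additive.

Definition mkadd (U V : zmodType) (f : U -> V) (fA : zmod_morphism f) :
  {additive U -> V} := HB.pack f (GRing.isZmodMorphism.Build U V f fA).

Definition subgroup (V : zmodType) (L : V -> Prop) :=
  L 0 /\ forall u v, L u -> L v -> L (u - v).

Definition subgroup_pred (V : zmodType) (L : V -> Prop) (_ : subgroup L) :
  {pred V} := fun x => `[<L x>].

Variables (V : zmodType) (L : V -> Prop).

Section Instance.
Variable hL : subgroup L.

Fact subgroup_pred_closed : zmod_closed (subgroup_pred hL).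
Proof.
case: hL => L0 LB; split; first exact/asboolP.
by move=> u v /asboolP Lu /asboolP Lv; apply/asboolP/LB.
Qed.

HB.instance Definition _ :=
  GRing.isZmodClosed.Build V (subgroup_pred hL) subgroup_pred_closed.

End Instance.

Lemma quotient_ex : subgroup L ->
  exists (Q : zmodType) (p : {additive V -> Q}),
    surjective p /\ forall v, p v = 0 <-> L v.
Proof.
move=> hL; pose Q := Quotient.quot (subgroup_pred hL).
exists Q, (\pi_Q%qT : {additive V -> Q}); split=> [q|v].
  by exists (repr q); apply: (reprK (q : Q)).
have pi0 : \pi_Q%qT 0 = 0 :> Q by exact: raddf0.
split=> [v0|/asboolP Lv].
  apply/asboolP; change (v \in subgroup_pred hL).
  by rewrite -[v]subr0 Quotient.idealrBE pi0 v0.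
by rewrite -[RHS]pi0; apply/eqP; rewrite -Quotient.idealrBE subr0.
Qed.

Lemma add_factor (U W : zmodType) (p : {additive U -> W})
    (f : {additive U -> V}) :
  surjective p -> (forall u, p u = 0 -> f u = 0) ->
  exists g : {additive W -> V}, forall u, g (p u) = f u.
Proof.
move=> /choice[s sP] f0.
have fs u : f (s (p u)) = f u.
  by apply/subr0_eq; rewrite -raddfB f0 // raddfB /= sP subrr.
have gA : zmod_morphism (fun w => f (s w)).
  move=> w w'; rewrite -{1}(sP w) -{1}(sP w') -raddfB fs raddfB.
  by rewrite -[w]sP -[w']sP !fs.
by exists (mkadd gA).
Qed.

End Additive.

Section Balanced.
Variables (R : pzRingType) (A : lmodType R^c) (F : lmodType R) (W : zmodType).
Variables (b : A -> F -> W) (bb : balanced b).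

Lemma bal0l x : b 0 x = 0.
Proof. by case: bb => bD _ _; apply: (addrI (b 0 x)); rewrite -bD !addr0. Qed.

Lemma bal0r a : b a 0 = 0.
Proof. by case: bb => _ bD _; apply: (addrI (b a 0)); rewrite -bD !addr0. Qed.

Lemma bal_suml (I : finType) (a : I -> A) x :
  b (\sum_i a i) x = \sum_i b (a i) x.
Proof.
have bD a1 a2 : b (a1 + a2) x = b a1 x + b a2 x by case: bb.
exact: (big_morph (b^~ x) bD (bal0l x)).
Qed.

Lemma balZ (r : R) a x : b ((r : R^c) *: a) x = b a (r *: x).
Proof. by case: bb. Qed.

Lemma balDr a x y : b a (x + y) = b a x + b a y.
Proof. by case: bb. Qed.

Lemma bal_sumr (I : finType) a (x : I -> F) :
  b a (\sum_i x i) = \sum_i b a (x i).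
Proof. exact: (big_morph (b a) (balDr a) (bal0r a)). Qed.

Lemma balBr a x y : b a (x - y) = b a x - b a y.
Proof. by apply: (addIr (b a y)); rewrite -balDr !subrK. Qed.

End Balanced.

(** Over a right module A with generators e_1, ..., e_n, the tensor product of
    A and F is the quotient of F^n by the subgroup spanned by the tuples
    (u_1 x, ..., u_n x) with u a relation between the e_j. *)
Section TensorPresentation.
Variables (R : pzRingType) (F : lmodType R).

Definition row_act n (v : 'rV[R^c]_n) (x : F) : {ffun 'I_n -> F} :=
  [ffun j => (v 0 j : R) *: x].

Lemma row_act_balanced n : balanced (@row_act n).
Proof.
split=> [v w x|v x y|r v x]; apply/ffunP => j; rewrite !ffunE.
- by rewrite mxE scalerDl.
- by rewrite scalerDr.
- by rewrite mxE scalerA.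
Qed.

Lemma row_act_sum n (z : {ffun 'I_n -> F}) :
  z = \sum_j row_act (delta_mx 0 j) (z j).
Proof.
apply/ffunP => k; rewrite sum_ffunE (bigD1 k) //= big1 => [|i ik].
  by rewrite ffunE mxE !eqxx scale1r addr0.
by rewrite ffunE mxE eq_sym (negPf ik) andbF scale0r.
Qed.

Definition ker_span n (A : lmodType R^c) (p : {linear 'rV[R^c]_n -> A})
    (z : {ffun 'I_n -> F}) :=
  exists (s : seq ('rV[R^c]_n * F)),
    (forall c, c \in s -> p c.1 = 0) /\ z = \sum_(c <- s) row_act c.1 c.2.

Lemma ker_span_subgroup n (A : lmodType R^c) (p : {linear 'rV[R^c]_n -> A}) :
  subgroup (ker_span p).
Proof.
split=> [|_ _ [s [s0 ->]] [t [t0 ->]]]; first by exists [::]; rewrite big_nil.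
exists (s ++ [seq (c.1, - c.2) | c <- t]); split=> [c|].
  by rewrite mem_cat => /orP[/s0//|/mapP[d /t0 d0 ->]].
rewrite big_cat big_map; congr (_ + _); rewrite -sumrN.
apply: eq_bigr => c _; rewrite -sub0r -[in RHS]sub0r.
by rewrite (balBr (@row_act_balanced n)) (bal0r (@row_act_balanced n)).
Qed.

Lemma tensor_presentation n (A : lmodType R^c) (p : {linear 'rV[R^c]_n -> A}) :
  surjective p ->
  exists (T : zmodType) (q : {additive {ffun 'I_n -> F} -> T})
         (t : A -> F -> T),
    [/\ is_tensor t, forall v x, q (row_act v x) = t (p v) x
      & forall z, q z = 0 -> ker_span p z].
Proof.
move=> pS; have [s sP] := choice pS.
have [T [q [qS qP]]] := quotient_ex (ker_span_subgroup p).
pose t a x := q (row_act (s a) x).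
have rb := @row_act_balanced n.
have tP v x : q (row_act v x) = t (p v) x.
  apply/subr0_eq; rewrite -raddfB; apply/qP.
  exists [:: (v - s (p v), x)]; split=> [c|].
    by rewrite inE => /eqP->; rewrite linearB /= sP subrr.
  rewrite big_seq1 /=; apply/ffunP => j.
  by rewrite !ffunE !mxE scalerBl.
exists T, q, t; split=> //; last by move=> z /qP.
split=> [|W b bb].
  split=> [a a' x|a x y|r a x].
  - rewrite -{1}(sP a) -{1}(sP a') -linearD -tP; case: rb => -> _ _.
    by rewrite raddfD.
  - by rewrite /t balDr // raddfD.
  - by rewrite -{1}(sP a) -linearZ -tP balZ.
have bA : zmod_morphism (fun z : {ffun 'I_n -> F} =>
                         \sum_j b (p (delta_mx 0 j)) (z j)).
  move=> z z'; rewrite -sumrB; apply: eq_bigr => j _.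
  by rewrite !ffunE balBr.
have bAE v x : mkadd bA (row_act v x) = b (p v) x.
  rewrite /= [in RHS](free_linE p v) bal_suml //; apply: eq_bigr => j _.
  by rewrite balZ // ffunE.
split=> [|u v ut vt w].
  have [|u uP] := add_factor (f := mkadd bA) qS.
    move=> z /qP[c [c0 ->]]; rewrite raddf_sum big_seq big1 // => d /c0 d0.
    by rewrite bAE d0 bal0l.
  by exists u => a x; rewrite -[a in LHS]sP -tP uP bAE sP.
have [z <-] := qS w; rewrite (row_act_sum z) !raddf_sum.
by apply: eq_bigr => j _; rewrite tP ut vt.
Qed.

(** A solution x in F of a homogeneous system over R is a combination of
    solutions in R.  Let A be the image of g, embedded by j in R^m.  Flatness
    makes A (x) F -> F^m injective; the class of x in A (x) F goes to the
    left-hand sides of the system, so it vanishes, and the presentation of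
    A (x) F says that x is spanned by the kernel of g. *)
Lemma flat_equations n m (g : {linear 'rV[R^c]_n -> 'rV[R^c]_m})
    (x : 'I_n -> F) :
  flat F ->
  (forall i, \sum_j (g (delta_mx 0 j) 0 i : R) *: x j = 0) ->
  ker_span g (finfun x).
Proof.
move=> Ff gx.
have [A [p [j [pS jI jpE]]]] := image_ex g.
have [TA [qA [tA [tAT tAE qA0]]]] := tensor_presentation pS.
have [TB [qB [tB [tBT tBE _]]]] :=
  @tensor_presentation m _ idfun (fun y => ex_intro _ y erefl).
have jb : balanced (fun a x => tB (j a) x).
  case: tBT => -[bD bD' bZ] _; split=> [a a' y|a y z|r a y].
  - by rewrite linearD bD.
  - by rewrite bD'.
  - by rewrite linearZ bZ.
have [[f fE] _] := tAT.2 _ _ jb.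
have fI := Ff _ _ j jI _ _ _ _ tAT tBT f fE.
have : qA (finfun x) = 0.
  apply: fI; rewrite raddf0 (row_act_sum (finfun x)) !raddf_sum.
  under eq_bigr do rewrite tAE fE jpE ffunE -[g _]/(idfun _) -tBE.
  rewrite -raddf_sum; set z := \sum_i _; suff -> : z = 0 by rewrite raddf0.
  apply/ffunP => i; rewrite /z sum_ffunE ffunE -[RHS](gx i).
  by apply: eq_bigr => k _; rewrite ffunE.
case/qA0 => s [s0 sE]; exists s; split=> // c /s0 c0.
by rewrite -jpE c0 linear0.
Qed.

End TensorPresentation.

Section FreeFlat.
Variables (R : pzRingType) (k : nat).

(** Any tensor product of A and R^k embeds in A^k: the map that sends
    (a_1, ..., a_k) to the sum of the a_j (x) e_j is a left inverse. *)
Lemma free_tensor_coords (A : lmodType R^c) (T : zmodType)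
    (t : A -> 'rV[R]_k -> T) : is_tensor t ->
  exists2 h : {additive T -> {ffun 'I_k -> A}},
    forall a v j, h (t a v) j = (v 0 j : R^c) *: a & injective h.
Proof.
move=> [tb tU].
pose b (a : A) (v : 'rV[R]_k) := [ffun j => (v 0 j : R^c) *: a].
have bb : balanced b.
  split=> [a a' v|a v w|r a v]; apply/ffunP => j; rewrite !ffunE.
  - by rewrite scalerDr.
  - by rewrite mxE scalerDl.
  - by rewrite mxE scalerA.
have [[h hE] _] := tU _ b bb.
exists h => [a v j|]; first by rewrite hE ffunE.
have lA : zmod_morphism (fun c : {ffun 'I_k -> A} => \sum_j t (c j) (delta_mx 0 j)).
  move=> c d; rewrite -sumrB; apply: eq_bigr => j _.
  case: (tb) => tD _ _; rewrite !ffunE.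
  by apply: (addIr (t (d j) (delta_mx 0 j))); rewrite -tD !subrK.
have lK : (mkadd lA \o h : {additive T -> T}) =1 idfun.
  apply: (tU _ t tb).2 => // a v /=.
  rewrite hE [in RHS](row_sum_delta v).
  under eq_bigr do rewrite ffunE balZ //.
  by rewrite bal_sumr.
by move=> x y e; have := lK x; rewrite /= e => <-; have := lK y.
Qed.

Lemma free_flat : flat 'rV[R]_k.
Proof.
move=> A B f fI TA TB tA tB tAT tBT fF fFE.
have [hA hAE hAI] := free_tensor_coords tAT.
have [hB hBE hBI] := free_tensor_coords tBT.
have gA : zmod_morphism (fun c : {ffun 'I_k -> A} => [ffun j => f (c j)]).
  by move=> c d; apply/ffunP => j; rewrite !ffunE linearB.
have gI : injective (mkadd gA).
  by move=> c d /ffunP cd; apply/ffunP => j; apply: fI; have := cd j; rewrite !ffunE.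
have e : (hB \o fF : {additive _ -> _}) =1 (mkadd gA \o hA : {additive _ -> _}).
  have bb : balanced (fun a v => hB (tB (f a) v)).
    case: tBT => -[tD tD' tZ] _; split=> [a a' v|a v w|r a v].
    - by rewrite linearD tD raddfD.
    - by rewrite tD' raddfD.
    - by rewrite linearZ tZ.
  apply: (tAT.2 _ _ bb).2 => a v /=; first by rewrite fFE.
  by apply/ffunP => j; rewrite ffunE hBE hAE linearZ.
move=> x y fxy; apply/hAI/gI; have := e x; have := e y => /= <- <-.
by rewrite fxy.
Qed.

End FreeFlat.

(** * Direct sums of modules, and the closure Add *)

Section Product.
Variables (R : pzRingType) (I : eqType) (A : I -> lmodType R).

Definition dprod := forall i, A i.
HB.instance Definition _ := gen_eqMixin dprod.
HB.instance Definition _ := gen_choiceMixin dprod.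

Definition dprod_add (x y : dprod) : dprod := fun i => x i + y i.
Definition dprod_opp (x : dprod) : dprod := fun i => - x i.
Definition dprod_scale a (x : dprod) : dprod := fun i => a *: x i.

Fact dprod_addA : associative dprod_add.
Proof. by move=> x y z; apply: functional_extensionality_dep => i; apply: addrA. Qed.
Fact dprod_addC : commutative dprod_add.
Proof. by move=> x y; apply: functional_extensionality_dep => i; apply: addrC. Qed.
Fact dprod_add0 : left_id (fun i => 0) dprod_add.
Proof. by move=> x; apply: functional_extensionality_dep => i; apply: add0r. Qed.
Fact dprod_addN : left_inverse (fun i => 0) dprod_opp dprod_add.
Proof. by move=> x; apply: functional_extensionality_dep => i; apply: addNr. Qed.

HB.instance Definition _ :=
  GRing.isZmodule.Build dprod dprod_addA dprod_addC dprod_add0 dprod_addN.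

Fact dprod_scaleA a b x : dprod_scale a (dprod_scale b x) = dprod_scale (a * b) x.
Proof. by apply: functional_extensionality_dep => i; apply: scalerA. Qed.
Fact dprod_scale1 : left_id 1 dprod_scale.
Proof. by move=> x; apply: functional_extensionality_dep => i; apply: scale1r. Qed.
Fact dprod_scaleDr : right_distributive dprod_scale +%R.
Proof. by move=> a x y; apply: functional_extensionality_dep => i; apply: scalerDr. Qed.
Fact dprod_scaleDl x : {morph dprod_scale^~ x : a b / a + b}.
Proof. by move=> a b; apply: functional_extensionality_dep => i; apply: scalerDl. Qed.

HB.instance Definition _ := GRing.Zmodule_isLmodule.Build R dprod
  dprod_scaleA dprod_scale1 dprod_scaleDr dprod_scaleDl.

Definition single i (a : A i) : dprod := dfwith (fun k => 0 : A k) a.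

Lemma single_linear i : linear (@single i).
Proof.
move=> t a b; apply: functional_extensionality_dep => k.
change (single (t *: a + b) k = t *: single a k + single b k); rewrite /single.
have [<-|ik] := eqVneq i k; first by rewrite !dfwith_in.
by rewrite !dfwith_out // scaler0 addr0.
Qed.

Definition fin_support (x : dprod) := exists s : seq I, forall i, x i <> 0 -> i \in s.

Lemma fin_support_submod : submodule fin_support.
Proof.
split=> [|a x y [s sP] [t tP]]; first by exists [::].
exists (s ++ t) => i xy0; rewrite mem_cat; apply/orP.
have [xi|/sP] := pselect (x i = 0); last by left.
right; apply: tP => yi; apply: xy0.
have -> : (a *: x + y) i = a *: x i + y i by [].
by rewrite xi yi scaler0 addr0.
Qed.

Lemma dsum_ex :
  exists (C : lmodType R) (inj : forall i, {linear A i -> C})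
         (pr : forall i, {linear C -> A i}),
    [/\ forall i a, pr i (inj i a) = a,
        forall i k a, i != k -> pr k (inj i a) = 0
      & forall x, exists s : seq I, forall t, uniq t -> {subset s <= t} ->
          x = \sum_(i <- t) inj i (pr i x)].
Proof.
have [C [j [jI jP]]] := submod_ex fin_support_submod.
have prL i : linear (fun x : C => j x i) by move=> a x y; rewrite linearP.
have [inj injP] : exists inj : forall i, {linear A i -> C},
    forall i a, j (inj i a) = single a.
  apply: (dchoice (P := fun i (f : {linear A i -> C}) =>
    forall a, j (f a) = single a)) => i.
  apply: (lin_lift_inj (f := mklin (@single_linear i)) jI) => a; apply/jP.
  exists [:: i] => k; rewrite inE /= /single.
  by have [//|ki] := eqVneq k i; rewrite dfwith_out // eq_sym.
exists C, inj, (fun i => mklin (prL i)); split=> /=.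
- by move=> i a; rewrite injP /single dfwith_in.
- by move=> i k a ik; rewrite injP /single dfwith_out.
move=> x; have /jP[s sP] : exists y, j y = j x by exists x.
exists s => t tU st; apply: jI; rewrite linear_sum /=.
apply: functional_extensionality_dep => k.
have sumE (r : seq I) (f : I -> dprod) : (\sum_(i <- r) f i) k = \sum_(i <- r) f i k.
  by elim/big_rec2: _ => // i y z _ <-.
rewrite sumE; under eq_bigr do rewrite injP /=.
have out i : i != k -> single (j x i) k = 0 by move=> ik; rewrite /single dfwith_out.
have [kt|kt] := boolP (k \in t).
  rewrite (bigD1_seq k) //= big1 => [|i /out//].
  by rewrite addr0 /single dfwith_in.
rewrite big_seq big1 => [|i it].
  by apply: contrapT => xk; case/negP: kt; apply/st/sP.
by apply: out; apply: contraNneq kt => <-.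
Qed.

End Product.

Section Coproduct.
Variable R : pzRingType.

(** The concrete form of a coproduct, with its projections.  The last clause
    allows every duplicate-free list that contains a given finite one, so that
    finitely many elements can be expanded over a common list. *)
Definition direct_sum (I : smallType) (A : I -> lmodType R) (C : lmodType R)
    (inj : forall i, {linear A i -> C}) (pr : forall i, {linear C -> A i}) :=
  [/\ forall i a, pr i (inj i a) = a,
      forall i k a, i <> k -> pr k (inj i a) = 0
    & forall x, exists s : seq {classic I}, forall t, uniq t ->
        {subset s <= t} -> x = \sum_(i <- t) inj i (pr i x)].

Lemma direct_sum_ex (I : smallType) (A : I -> lmodType R) :
  exists C inj pr, @direct_sum I A C inj pr.
Proof.
have [C [inj [pr [h1 h2 h3]]]] := @dsum_ex R {classic I} A.
by exists C, inj, pr; split=> // i k a ik; apply: h2; apply/eqP.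
Qed.

Section DirectSumTheory.
Variables (I : smallType) (A : I -> lmodType R) (C : lmodType R).
Variables (inj : forall i, {linear A i -> C}) (pr : forall i, {linear C -> A i}).
Hypothesis CS : direct_sum inj pr.

Lemma direct_sum_supp x : exists s : seq {classic I},
  [/\ uniq s, x = \sum_(i <- s) inj i (pr i x)
    & forall i, i \notin s -> pr i x = 0].
Proof.
case: CS => _ out fin; have [s sP] := fin x.
have xE := sP _ (undup_uniq s) (fun i => (etrans (mem_undup s i))).
exists (undup s); split=> // [|k ks]; first exact: undup_uniq.
rewrite xE linear_sum big_seq big1 //= => i si; apply: out => ik.
by rewrite -ik si in ks.
Qed.

Lemma direct_sum_ext x y : (forall i, pr i x = pr i y) -> x = y.
Proof.
move=> xy; apply/subr0_eq.
have [s [_ -> _]] := direct_sum_supp (x - y).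
by rewrite big1 // => i _; rewrite linearB xy subrr linear0.
Qed.

Lemma direct_sum_homP (N : lmodType R) (u v : {linear C -> N}) :
  (forall i x, u (inj i x) = v (inj i x)) -> u =1 v.
Proof.
move=> uv x; have [s [_ -> _]] := direct_sum_supp x.
by rewrite !linear_sum; apply: eq_bigr.
Qed.

(** The value at x is the sum of the f_i (pr_i x) over a support of x; it does
    not depend on the support, whence linearity. *)
Lemma direct_sum_hom (N : lmodType R) (f : forall i, {linear A i -> N}) :
  exists u : {linear C -> N}, forall i x, u (inj i x) = f i x.
Proof.
have [s sP] := choice direct_sum_supp.
have sumE x (t : seq {classic I}) : uniq t -> {subset s x <= t} ->
    \sum_(i <- s x) f i (pr i x) = \sum_(i <- t) f i (pr i x).
  move=> tU st; have [sU _ s0] := sP x.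
  rewrite [RHS](bigID (mem (s x))) /= [X in _ + X]big1 => [|i /s0->]; last first.
    by rewrite linear0.
  rewrite addr0 -[RHS]big_filter; apply: perm_big.
  apply: uniq_perm => //; first exact: filter_uniq.
  move=> i; rewrite mem_filter /=.
  by case: (boolP (i \in s x)) => // /st->.
have uL : linear (fun x => \sum_(i <- s x) f i (pr i x)).
  move=> a x y; pose t := undup (s (a *: x + y) ++ s x ++ s y).
  have tP z : {subset s z <= s (a *: x + y) ++ s x ++ s y} ->
      \sum_(i <- s z) f i (pr i z) = \sum_(i <- t) f i (pr i z).
    by move=> sz; apply: sumE => [|i /sz]; rewrite ?undup_uniq ?mem_undup.
  rewrite !tP.
  - rewrite scaler_sumr -big_split; apply: eq_bigr => i _ /=.
    by rewrite !linearP.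
  - by move=> i iy; rewrite !mem_cat iy !orbT.
  - by move=> i iy; rewrite !mem_cat iy !orbT.
  - by move=> i iy; rewrite !mem_cat iy.
exists (mklin uL) => i x /=; case: CS => prK out _.
pose t := undup ((i : {classic I}) :: s (inj i x)).
rewrite (sumE _ t); last 2 first.
- exact: undup_uniq.
- by move=> k ks; rewrite mem_undup inE ks orbT.
rewrite (bigD1_seq (i : {classic I})) /= ?undup_uniq ?mem_undup ?mem_head //.
rewrite prK big1 ?addr0 // => k /eqP ki.
by rewrite out ?linear0 // => ik; apply: ki.
Qed.

Lemma direct_sum_fg (N : lmodType R) (h : {linear N -> C}) :
  fin_generated N ->
  exists s : seq {classic I}, uniq s /\
    forall x, h x = \sum_(i <- s) inj i (pr i (h x)).
Proof.
move=> [n [f fS]]; case: (CS) => _ _ fin.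
have [s sP] := choice (fun k : 'I_n => fin (h (f (delta_mx 0 k)))).
pose t := undup (flatten [seq s k | k <- enum 'I_n]).
exists t; split=> [|x]; first exact: undup_uniq.
have [v <-] := fS x.
have gL : linear (fun x => \sum_(i <- t) inj i (pr i (h x))).
  move=> a y z; rewrite scaler_sumr -big_split; apply: eq_bigr => i _ /=.
  by rewrite !linearP.
rewrite -[RHS]/(mklin gL (f v)) (free_linE f v) !linear_sum; apply: eq_bigr => k _.
rewrite !linearZ /=; congr (_ *: _); apply: sP => [|i ik]; first exact: undup_uniq.
rewrite mem_undup; apply/flattenP; exists (s k) => //.
by apply: map_f; rewrite mem_enum.
Qed.

End DirectSumTheory.
End Coproduct.

Section Purity.
Variable R : pzRingType.

Lemma free_fin_presented n : fin_presented 'rV[R]_n.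
Proof.
exists 0%N, n, \0, idfun; split=> [x|x]; first by exists x.
by split=> [x0|[y <-] //]; exists 0; rewrite -[x]/(idfun x) x0.
Qed.

Lemma point_ex (A : lmodType R) (a : A) :
  exists f : {linear 'rV[R]_1 -> A}, f (delta_mx 0 0) = a.
Proof.
have [f fE] := @free_lin R 1 A (fun=> a); exists f.
by rewrite fE big_ord1 mxE eqxx scale1r.
Qed.

Lemma pure_exact_comp0 (A B C : lmodType R) (f : {linear A -> B})
    (g : {linear B -> C}) : pure_exact f g -> forall a, g (f a) = 0.
Proof.
move=> fg a; have [l <-] := point_ex a; move: (delta_mx 0 0).
by apply/(fg _ (free_fin_presented 1) (f \o l)); exists l.
Qed.

End Purity.

Section AddClosure.
Variables (R : pzRingType) (X : modClass R).

Lemma Add_retract (M N : lmodType R) (s : {linear M -> N}) (r : {linear N -> M}) :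
  cancel s r -> Add X N -> Add X M.
Proof.
move=> sK [I [A [C [inj [XA CS [s' [r' sK']]]]]]].
exists I, A, C, inj; split=> //; exists (s' \o s), (r \o r') => x /=.
by rewrite sK' sK.
Qed.

Lemma Add_in (M : lmodType R) : X M -> Add X M.
Proof.
move=> XM; exists unit, (fun=> M), M, (fun=> idfun); split=> //.
  move=> N f; split=> [|u v uf vf x]; first by exists (f tt) => -[].
  by rewrite (uf tt x) (vf tt x).
by exists idfun, idfun.
Qed.

(** If each A_i is a retract of a coproduct of the B_ij, then the direct sum of
    the A_i is a retract of the coproduct of all the B_ij, indexed by the
    pairs (i, j). *)
Lemma Add_direct_sum (I : smallType) (A : I -> lmodType R) (C : lmodType R)
    (inj : forall i, {linear A i -> C}) (pr : forall i, {linear C -> A i}) :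
  direct_sum inj pr -> (forall i, Add X (A i)) -> Add X C.
Proof.
move=> CS /dchoice[J] /dchoice[B] /dchoice[D] /dchoice[k] kP.
have [E [iE [pE ES]]] := direct_sum_ex D.
exists {i : I & J i}, (fun ij => B _ (tagged ij)), E,
  (fun ij => iE (tag ij) \o k _ (tagged ij)); split=> [[i j]||].
- by case: (kP i).
- move=> N f; split=> [|u v uf vf].
    have [g gP] : exists g : forall i, {linear D i -> N},
        forall i j x, g i (k i j x) = f (Tagged J j) x.
      apply: (dchoice (P := fun i (g : {linear D i -> N}) => forall j x,
               g (k i j x) = f (Tagged J j) x)) => i.
      by case: (kP i) => _ /(_ N (fun j => f (Tagged J j)))[].
    have [u uP] := direct_sum_hom ES g.
    by exists u => -[i j] x /=; rewrite uP gP.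
  apply: (direct_sum_homP ES) => i.
  case: (kP i) => _ /(_ N (fun j => f (Tagged J j)))[_ uniq] _.
  apply: (uniq (u \o iE i) (v \o iE i)) => j x /=.
    exact: (uf (Tagged J j)).
  exact: (vf (Tagged J j)).
have [s] : exists s : forall i, {linear A i -> D i}, forall i,
    exists r : {linear D i -> A i}, cancel (s i) r.
  apply: (dchoice (P := fun i (s : {linear A i -> D i}) =>
    exists r : {linear D i -> A i}, cancel s r)) => i.
  by case: (kP i).
move=> /dchoice[r rP].
have [S SP] := direct_sum_hom CS (fun i => iE i \o s i).
have [T TP] := direct_sum_hom ES (fun i => inj i \o r i).
exists S, T => x.
apply: (direct_sum_homP CS (u := T \o S) (v := idfun)) => i a /=.
by rewrite SP /= TP /= rP.
Qed.

(** A coproduct in the sense of the universal property maps isomorphically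
    to a direct sum, where elements are separated by the projections. *)
Lemma Add_separated (M : lmodType R) (x : M) :
  Add X M -> (forall (A : lmodType R) (f : {linear M -> A}), X A -> f x = 0) -> x = 0.
Proof.
move=> [I [A [C [inj [XA CS [s [r sK]]]]]]] x0.
have [E [iE [pE ES]]] := direct_sum_ex A.
have [[u uP] _] := CS E iE.
have [v vP] := direct_sum_hom ES inj.
have vu : (v \o u : {linear _ -> _}) =1 idfun.
  by apply: (CS C inj).2 => // i y; rewrite /= uP vP.
rewrite -[x]sK -[s x]vu /= (_ : u (s x) = 0) ?linear0 //.
apply: (direct_sum_ext ES) => i; rewrite linear0.
exact: (x0 _ (pE i \o u \o s)).
Qed.

Lemma Add_pure_projective (M : lmodType R) :
  (forall A, X A -> fin_presented A) -> Add X M -> pure_projective M.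
Proof.
move=> Xfp [I [N [S [inj [XN NS [s [r sK]]]]]]] A B C f g fg h.
have gf0 := pure_exact_comp0 fg.
split=> [gh|[k kP] x]; last by rewrite -kP.
have [k kP] : exists k : forall i, {linear N i -> A},
    forall i x, f (k i x) = h (r (inj i x)).
  apply: (dchoice (P := fun i (k : {linear N i -> A}) => forall x,
           f (k x) = h (r (inj i x)))) => i.
  by apply/(fg _ (Xfp _ (XN i)) (h \o r \o inj i)) => x /=.
have [[u uP] _] := NS A k.
have fu : (f \o u : {linear _ -> _}) =1 (h \o r : {linear _ -> _}).
  by apply: (NS B (fun i => h \o r \o inj i)).2 => // i x; rewrite /= uP kP.
by exists (u \o s) => x; have := fu (s x); rewrite /= sK.
Qed.

End AddClosure.

(** * The epireflection of finitely presented modules into sub Flat *)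

Section Reflection.
Variable R : pzRingType.

Lemma sub_flat_image n k (S : lmodType R) (p : {linear 'rV[R]_n -> S})
    (j : {linear S -> 'rV[R]_k}) :
  left_noetherian R -> surjective p -> injective j -> sub (@flat R) S.
Proof.
move=> nR pS jI; split; last first.
  by exists 'rV[R]_k; [exact: free_flat | exists j].
by apply: noetherian_fin_presented => //; exists n, p.
Qed.

(** The matrix of g, multiplied with columns.  Columns over R, as right modules,
    are rows over the converse ring. *)
Lemma transpose_ex n m (g : {linear 'rV[R]_m -> 'rV[R]_n}) :
  exists g' : {linear 'rV[R^c]_n -> 'rV[R^c]_m},
    forall c i, g' c 0 i = \sum_j g (delta_mx 0 i) 0 j * (c 0 j : R) :> R.
Proof.
have gL : linear (fun c : 'rV[R^c]_n =>
    \row_i ((\sum_j g (delta_mx 0 i) 0 j * (c 0 j : R) : R) : R^c)).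
  move=> a c d; apply/rowP => i; rewrite !mxE.
  change (\sum_j g (delta_mx 0 i) 0 j * ((a *: c + d) 0 j : R) =
   (\sum_j g (delta_mx 0 i) 0 j * (c 0 j : R)) * (a : R) +
   \sum_j g (delta_mx 0 i) 0 j * (d 0 j : R) :> R).
  rewrite mulr_suml -big_split; apply: eq_bigr => j _ /=.
  by rewrite !mxE -mulrA -mulrDr.
by exists (mklin gL) => c i; rewrite mxE.
Qed.

Lemma transpose_delta n m (g : {linear 'rV[R]_m -> 'rV[R]_n})
    (g' : {linear 'rV[R^c]_n -> 'rV[R^c]_m}) :
  (forall c i, g' c 0 i = \sum_j g (delta_mx 0 i) 0 j * (c 0 j : R) :> R) ->
  forall i j, g' (delta_mx 0 j) 0 i = g (delta_mx 0 i) 0 j.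
Proof.
move=> gE i j; rewrite gE (bigD1 j) //= big1 => [|k kj].
  by rewrite addr0 mxE !eqxx mulr1.
by rewrite mxE (negPf kj) andbF mulr0.
Qed.

(** If N is the cokernel of g : R^m -> R^n, the functionals on N are the columns
    killed by the matrix of g; they are generated by the columns of a matrix
    c, and S is the row space of c, that is, the image of N in R^k.
    For h : N -> M and A in sub Flat, embedded in a flat module F, the images
    in F of the generators of N solve the system given by g, so they are
    combinations of the columns of c: everything that c kills is killed by
    all maps M -> A, hence by h. *)
Lemma sub_flat_reflection (N : lmodType R) :
  left_noetherian R -> right_coherent R -> fin_presented N ->
  exists n k (c : {linear 'rV[R]_n -> 'rV[R]_k}),
  forall (S : lmodType R) (p : {linear 'rV[R]_n -> S})
         (j : {linear S -> 'rV[R]_k}),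
    surjective p -> injective j -> (forall v, j (p v) = c v) ->
  exists2 q : {linear N -> S}, surjective q &
    forall (M : lmodType R) (h : {linear N -> M}), Add (sub (@flat R)) M ->
      exists h' : {linear S -> M}, forall x, h' (q x) = h x.
Proof.
move=> nR cR [m [n [g [f [fS gf]]]]].
have [g' g'E] := transpose_ex g.
have [k [d dE]] := coherent_ker g' cR.
have cL : linear (fun v : 'rV[R]_n =>
    \row_t (\sum_i v 0 i * (d (delta_mx 0 t) 0 i : R)) : 'rV[R]_k).
  move=> a u v; apply/rowP => t; rewrite !mxE mulr_sumr -big_split.
  by apply: eq_bigr => i _ /=; rewrite !mxE mulrDl mulrA.
exists n, k, (mklin cL) => S p j pS jI jpE.
have pg v : p (g v) = 0.
  rewrite (free_linE g) linear_sum big1 // => i _; rewrite linearZ /=.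
  suff -> : p (g (delta_mx 0 i)) = 0 by rewrite scaler0.
  apply: jI; rewrite jpE linear0; apply/rowP => t; rewrite !mxE.
  rewrite -g'E (_ : g' _ = 0) ?mxE //; apply/dE.
  by exists (delta_mx 0 t).
have [|q qE] := lin_factor (f := p) fS.
  by move=> u /gf[w <-].
exists q => [s|M h XM].
  by have [u <-] := pS s; exists (f u); rewrite qE.
apply: lin_factor => [s|y]; first by have [u <-] := pS s; exists (f u).
have [v <-] := fS y; rewrite qE => pv0.
apply: (Add_separated XM) => A phi [Afp [F Fflat [jA jAI]]].
apply: jAI; rewrite linear0.
pose psi : {linear 'rV[R]_n -> F} := jA \o phi \o h \o f.
have psig w : psi (g w) = 0.
  by rewrite /psi /= (_ : f _ = 0) ?linear0 //; apply/gf; exists w.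
have [i|s [s0 sE]] := @flat_equations R F _ _ g' (fun i => psi (delta_mx 0 i)) Fflat.
  rewrite -[RHS](psig (delta_mx 0 i)) (free_linE psi); apply: eq_bigr => l _.
  by rewrite (transpose_delta g'E).
change (psi v = 0); rewrite (free_linE psi).
have xE i : psi (delta_mx 0 i) = \sum_(c <- s) (c.1 0 i : R) *: c.2.
  have := congr1 (fun z : {ffun _} => z i) sE; rewrite ffunE => ->.
  rewrite sum_ffunE; apply: eq_bigr => c _; by rewrite ffunE.
under eq_bigr do rewrite xE scaler_sumr.
rewrite exchange_big big_seq big1 //= => -[u z] /s0 /= /dE[a uE].
under eq_bigr do rewrite scalerA.
rewrite -scaler_suml; suff -> : \sum_i v 0 i * (u 0 i : R) = 0 by rewrite scale0r.
have uiE i : u 0 i = \sum_t (d (delta_mx 0 t) 0 i : R) * (a 0 t : R) :> R.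
  rewrite -uE (free_linE d) summxE; apply: eq_bigr => t _.
  by rewrite mxE.
under eq_bigr do rewrite uiE mulr_sumr.
rewrite exchange_big big1 //= => t _.
under eq_bigr do rewrite mulrA.
rewrite -mulr_suml; have := jpE v; rewrite pv0 linear0 => /rowP/(_ t).
by rewrite !mxE => <-; rewrite mul0r.
Qed.

End Reflection.

(** * Pure acyclic complexes of pure projective modules *)

Section PureDimension.
Variable R : pzRingType.
Implicit Types K N P Q : lmodType R.

Definition pure_epi P N (p : {linear P -> N}) :=
  forall (F : lmodType R) (h : {linear F -> N}), fin_presented F ->
    exists k : {linear F -> P}, forall x, p (k x) = h x.

Definition pure_ses K P N (i : {linear K -> P}) (p : {linear P -> N}) :=
  [/\ injective i, exact_at 0 i p & pure_epi p].

Lemma pure_projective_lift Q P N (p : {linear P -> N}) (h : {linear Q -> N}) :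
  pure_projective Q -> pure_epi p ->
  exists k : {linear Q -> P}, forall x, p (k x) = h x.
Proof.
move=> Qpp pE; apply/(Qpp _ _ _ p (\0 : {linear N -> 'rV[R]_0})) => //.
by move=> F Ffp l; split=> // _; apply: pE.
Qed.

(** N' is a retract of N modulo maps that factor through pure projectives.
    This takes the place of Ext in dimension shifting: the relation passes to
    syzygies, and pure projectivity passes to stable retracts. *)
Definition stable_retract N' N :=
  exists (a : {linear N' -> N}) (b : {linear N -> N'}) (Q : lmodType R)
         (p : {linear N' -> Q}) (q : {linear Q -> N'}),
    pure_projective Q /\ forall x, b (a x) - x = q (p x).

Lemma stable_retract_pure_projective N' N :
  stable_retract N' N -> pure_projective N -> pure_projective N'.
Proof.
move=> [a [b [Q [p [q [Qpp e]]]]]] Npp A B C f g fg h.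
have gf0 := pure_exact_comp0 fg.
split=> [gh|[k kP] x]; last by rewrite -kP.
have [|k1 k1P] := (Npp _ _ _ _ _ fg (h \o b)).1; first by move=> x /=.
have [|k2 k2P] := (Qpp _ _ _ _ _ fg (h \o q)).1; first by move=> x /=.
exists ((k1 \o a) \- (k2 \o p)) => x.
rewrite /= linearB /= k1P k2P /= -linearB -e.
by rewrite opprB addrC subrK.
Qed.

(** Lift a and b to al : P' -> P and be : P -> P', and lift q to P'.  Then
    be o al - id - q1 o r o p' takes its values in K', and its restriction to
    K' is b_K o a_K - id, since p' vanishes there.  So the latter
    factors through the inclusion of K' in P'. *)
Lemma stable_retract_syzygy K P N K' P' N' (i : {linear K -> P})
    (p : {linear P -> N}) (i' : {linear K' -> P'}) (p' : {linear P' -> N'}) :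
  pure_ses i p -> pure_ses i' p' -> pure_projective P -> pure_projective P' ->
  stable_retract N' N -> stable_retract K' K.
Proof.
move=> [iI ip pE] [i'I ip' pE'] Ppp Ppp' [a [b [Q [r [q [Qpp e]]]]]].
have [al alP] := pure_projective_lift (a \o p') Ppp' pE.
have [be beP] := pure_projective_lift (b \o p) Ppp pE'.
have [q1 q1P] := pure_projective_lift q Qpp pE'.
have pi x : p (i x) = 0 by apply/ip; exists x.
have pi' x : p' (i' x) = 0 by apply/ip'; exists x.
have [|aK aKP] := lin_lift_inj (f := al \o i') iI.
  by move=> x; apply/ip; rewrite /= alP /= pi' linear0.
have [|bK bKP] := lin_lift_inj (f := be \o i) i'I.
  by move=> x; apply/ip'; rewrite /= beP /= pi linear0.
have [|s sP] := lin_lift_inj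
    (f := ((be \o al) \- idfun) \- (q1 \o r \o p')) i'I.
  move=> x; apply/ip'; rewrite /= !linearB /= beP /= alP /= q1P -e.
  exact: subrr.
exists aK, bK, P', i', s; split=> // x; apply: i'I.
by rewrite linearB /= bKP /= aKP sP /= pi' !linear0 addr0.
Qed.

(** Pure resolutions of length d - 1.  With the zero module as base case, pure
    projective modules have dimension at most one here. *)
Fixpoint pure_dim d N :=
  if d is d'.+1 then
    exists (K P : lmodType R) (i : {linear K -> P}) (p : {linear P -> N}),
      [/\ pure_projective P, pure_ses i p & pure_dim d' K]
  else forall x : N, x = 0.

Lemma zero_pure_projective N : (forall x : N, x = 0) -> pure_projective N.
Proof.
move=> N0 A B C f g fg h.
split=> [_|[k kP] x]; last by rewrite -kP (pure_exact_comp0 fg).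
by exists \0 => x; rewrite (N0 x) !linear0.
Qed.

Lemma resolution_pure_dim d (P : nat -> lmodType R)
    (del : forall i, {linear P i.+1 -> P i}) N (aug : {linear P 0%N -> N}) :
  (forall i, pure_projective (P i)) ->
  (forall i, (d <= i)%N -> forall x : P i, x = 0) ->
  pure_exact aug (\0 : {linear N -> 'rV[R]_0}) ->
  pure_exact (del 0%N) aug ->
  (forall i, pure_exact (del i.+1) (del i)) -> pure_dim d N.
Proof.
elim: d P del N aug => [|d IHd] P del N aug Ppp P0 augE d0E dE /=.
  move=> x; have [l <-] := point_ex x.
  have [|k <-] := (augE _ (free_fin_presented _ 1) l).1; first by [].
  by rewrite (P0 0%N _ (k _)) // linear0.
have [K [i [iI iP]]] := submod_ex (ker_submod aug).
have [|aug' augP] := lin_lift_inj (f := del 0%N) iI.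
  by move=> x; apply/iP/(pure_exact_comp0 d0E).
exists K, (P 0%N), i, aug; split=> //.
  split=> // F h Ffp; exact: (augE F Ffp h).1.
apply: (IHd (fun i => P i.+1) (fun i => del i.+1) K aug') => //.
- by move=> k dk; apply: P0.
- move=> F Ffp h; split=> // _.
  have [|k kP] := (d0E F Ffp (i \o h)).1; first by move=> x; apply/iP; exists (h x).
  by exists k => x; apply: iI; rewrite augP kP.
- move=> F Ffp h; rewrite -(dE 0%N F Ffp h); split=> hx x.
    by rewrite -augP hx linear0.
  by apply: iI; rewrite augP hx linear0.
Qed.

End PureDimension.

Section Contraction.
Variables (R : pzRingType) (C : int -> lmodType R).
Variable del : forall n, {linear C (n + 1) -> C n}.
Hypothesis delK : forall n x, del n (del (n + 1) x) = 0.

(** Differentials are indexed by their target, so facts about C_n as the source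
    of a differential are available only for n of the form m + 1. *)
Lemma int_succ_ind (P : int -> Prop) : (forall n, P (n + 1)) -> forall n, P n.
Proof. by move=> PS n; rewrite -(subrK 1 n); apply: PS. Qed.

Definition pure_acyclic :=
  forall n (F : lmodType R) (h : {linear F -> C (n + 1)}), fin_presented F ->
    (forall x, del n (h x) = 0) ->
    exists k : {linear F -> C (n + 1 + 1)}, forall x, del (n + 1) (k x) = h x.

Hypothesis acC : pure_acyclic.
Hypothesis ppC : forall n, pure_projective (C n).
Hypothesis gldimR : finite_left_pure_gldim R.

Lemma pure_acyclic_boundary n (F : lmodType R) (h : {linear F -> C n}) :
  fin_presented F -> (forall x, exists y, del n y = h x) ->
  exists k : {linear F -> C (n + 1)}, forall x, del n (k x) = h x.
Proof.
elim/int_succ_ind: n F h => n F h Ffp hx; apply: acC => // x.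
by have [y <-] := hx x; rewrite delK.
Qed.

(** Splitting C into short pure exact sequences.  Boundaries are taken rather
    than cycles, since the cycles of degree n involve the differential
    out of C_n, whose index would have to be n - 1. *)
Lemma boundaries_ex :
  exists (B : int -> lmodType R) (p : forall n, {linear C (n + 1) -> B n})
         (j : forall n, {linear B n -> C n}),
    (forall n x, j n (p n x) = del n x) /\
    forall n, pure_ses (j (n + 1)) (p n).
Proof.
have /dchoice[B /dchoice[p /dchoice[j jP]]] := fun n => image_ex (del n).
have pS n : surjective (p n) by case: (jP n).
have jI n : injective (j n) by case: (jP n).
have jpE n x : j n (p n x) = del n x by case: (jP n).
exists B, p, j; split=> // n; split=> //.
- move=> x; split=> [px|[b <-]].
    have [l lx] := point_ex x.
    have [|k kP] := acC (h := l) (free_fin_presented _ 1).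
      move=> v; rewrite -jpE (free_linE l v) big_ord1 lx linearZ /= px.
      by rewrite scaler0 linear0.
    by exists (p (n + 1) (k (delta_mx 0 0))); rewrite jpE kP.
  by have [y <-] := pS _ b; apply: jI; rewrite !jpE delK linear0.
- move=> F h Ffp; have [|k kP] := pure_acyclic_boundary (h := j n \o h) Ffp.
    by move=> x /=; have [y <-] := pS _ (h x); exists y; rewrite /= jpE.
  by exists k => x; apply: jI; rewrite jpE kP.
Qed.

(** A resolution of B_n of length d is matched with the complex C itself:
    B_(n+1), B_(n+2), ... are stable retracts of the successive syzygies of the
    resolution, the last of which is zero. *)
Lemma boundaries_pure_projective (B : int -> lmodType R)
    (p : forall n, {linear C (n + 1) -> B n}) (j : forall n, {linear B n -> C n}) :
  (forall n, pure_ses (j (n + 1)) (p n)) -> forall n, pure_projective (B n).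
Proof.
move=> ses.
have shift d n N : pure_dim d N -> stable_retract (B n) N ->
    pure_projective (B (n + d%:Z)).
  elim: d n N => [|d IHd] n N /=.
    move=> /zero_pure_projective Npp st; rewrite addr0.
    exact: stable_retract_pure_projective st Npp.
  move=> [K [P [i [q [Ppp iq Kd]]]]] st.
  have -> : n + d.+1%:Z = n + 1 + d%:Z by rewrite -addrA -intS.
  apply: IHd Kd _.
  exact: stable_retract_syzygy iq (ses n) Ppp (@ppC _) st.
have [d dP] := gldimR => n.
rewrite -(subrK d.+1%:Z n); apply: shift.
  have [P [de [aug [Ppp P0 h1 h2 h3]]]] := dP (B (n - d.+1%:Z)).
  exact: resolution_pure_dim Ppp P0 h1 h2 h3.
exists idfun, idfun, 'rV[R]_0, \0, \0; split=> [|x]; last by rewrite subrr.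
by apply: zero_pure_projective => x; rewrite [x]thinmx0.
Qed.

(** Sections si of C_(n+1) -> B_n yield retractions rho of B_n in C_n.  The
    section complementary to rho is si - rho o si, and the contraction is
    C_n -> B_n -> C_(n+1), by rho and then that section. *)
Lemma pure_acyclic_contraction :
  exists s : forall n, {linear C n -> C (n + 1)},
    forall n x, x = del (n + 1) (s (n + 1) x) + s n (del n x).
Proof.
have [B [p [j [jpE ses]]]] := boundaries_ex.
have ppB := boundaries_pure_projective ses.
have /dchoice[si siP] : forall n, exists s : {linear B n -> C (n + 1)},
    forall b, p n (s b) = b.
  by move=> n; apply: (pure_projective_lift idfun) => //; case: (ses n).
have jI n : injective (j n) by elim/int_succ_ind: n => n; case: (ses n).
have pj n b : p n (j (n + 1) b) = 0.
  by case: (ses n) => _ e _; apply/e; exists b.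
have pjE n x : exists b, j (n + 1) b = x - si n (p n x).
  by case: (ses n) => _ e _; apply/e; rewrite linearB siP subrr.
have /dchoice[rho rhoP] : forall n, exists r : {linear C n -> B n},
    forall b, r (j n b) = b.
  elim/int_succ_ind => n.
  have [|r rP] := lin_lift_inj (f := idfun \- (si n \o p n)) (jI (n + 1)).
    by move=> x; apply: pjE.
  by exists r => b; apply: jI; rewrite rP /= pj linear0 subr0.
exists (fun n => (si n \- (j (n + 1) \o rho (n + 1) \o si n)) \o rho n) => n x /=.
rewrite -!jpE linearB /= siP pj subr0 rhoP.
have [b bE] := pjE n x.
have -> : rho (n + 1) x = b + rho (n + 1) (si n (p n x)).
  by rewrite -[b]rhoP bE -linearD subrK.
by rewrite linearD bE -addrA [_ + (_ - _)]addrC !subrK.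
Qed.

End Contraction.

(** * Stalk complexes and coproducts in the homotopy category *)

Section Homotopy.
Variables (R : pzRingType) (X : modClass R).
Implicit Types C D E : complex X.

Lemma homotopic_ext C D (f g : chain_map C D) :
  (forall n x, f n x = g n x) -> homotopic f g.
Proof.
by move=> fg; exists (fun=> \0) => n x; rewrite fg subrr linear0 add0r.
Qed.

Lemma homotopic_sym C D (f g : chain_map C D) : homotopic f g -> homotopic g f.
Proof.
move=> [s sP]; exists (fun n => \- s n) => n x.
by rewrite -[LHS]opprB sP /= linearN -opprD.
Qed.

Lemma homotopic_trans C D (g f h : chain_map C D) :
  homotopic f g -> homotopic g h -> homotopic f h.
Proof.
move=> [s sP] [t tP]; exists (fun n => s n \+ t n) => n x.
by rewrite -(subrK (g (n + 1) x) (f (n + 1) x)) -addrA sP tP linearD addrACA.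
Qed.

Lemma homotopic_compl C D E (h : chain_map D E) (f g : chain_map C D) :
  homotopic f g -> homotopic (chain_comp h f) (chain_comp h g).
Proof.
move=> [s sP]; exists (fun n => h (n + 1) \o s n) => n x /=.
by rewrite -linearB sP linearD cmapP.
Qed.

Lemma homotopic_compr C D E (h : chain_map C D) (f g : chain_map D E) :
  homotopic f g -> homotopic (chain_comp f h) (chain_comp g h).
Proof.
move=> [s sP]; exists (fun n => s n \o h n) => n x /=.
by rewrite sP cmapP.
Qed.

Lemma homotopic_add C D (f f' g g' : chain_map C D) :
  homotopic f f' -> homotopic g g' ->
  homotopic (chain_add f g) (chain_add f' g').
Proof.
move=> [s sP] [t tP]; exists (fun n => s n \+ t n) => n x /=.
by rewrite opprD addrACA sP tP linearD addrACA.
Qed.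

Lemma contractible_zero_object C (s : forall n, {linear C n -> C (n + 1)}) :
  (forall n x, x = cdiff C (n + 1) (s (n + 1) x) + s n (cdiff C n x)) ->
  zero_object C.
Proof.
move=> sP Z; split=> f.
  exists (fun n => f (n + 1) \o s n) => n x.
  by rewrite /= subr0 {1}[x]sP linearD cmapP.
exists (fun n => s n \o f n) => n x.
by rewrite /= subr0 {1}[f _ x]sP cmapP.
Qed.

Section SumMap.
Variables (I : smallType) (D : I -> complex X) (C Y : complex X).
Variables (m : nat) (e : 'I_m -> I) (g : forall k, chain_map C (D (e k))).

Lemma sum_mapE (inj : forall i, chain_map (D i) Y) n x :
  sum_map inj g n x = \sum_k inj (e k) n (g k n x).
Proof.
rewrite /sum_map; elim/big_rec2: _ => [//|k y f _ <-] /=.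
by rewrite addrC.
Qed.

Lemma homotopic_sum_map (inj inj' : forall i, chain_map (D i) Y) :
  (forall i, homotopic (inj i) (inj' i)) ->
  homotopic (sum_map inj g) (sum_map inj' g).
Proof.
move=> h; rewrite /sum_map; elim/big_rec2: _ => [|k f f' _ ff'].
  exact: homotopic_ext.
by apply: homotopic_add => //; apply: homotopic_compr.
Qed.

End SumMap.

Lemma chain_comp_sum_map (I : smallType) (D : I -> complex X) (C Y Z : complex X)
    (m : nat) (e : 'I_m -> I) (g : forall k, chain_map C (D (e k)))
    (inj : forall i, chain_map (D i) Y) (u : chain_map Y Z) n x :
  chain_comp u (sum_map inj g) n x =
  sum_map (fun i => chain_comp u (inj i)) g n x.
Proof. by rewrite /= !sum_mapE linear_sum. Qed.

Definition degreewise_sum (I : smallType) (D : I -> complex X) (Y : complex X)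
    (inj : forall i, chain_map (D i) Y) (pr : forall i, chain_map Y (D i)) :=
  forall n, direct_sum (fun i => inj i n) (fun i => pr i n).

Lemma degreewise_sum_coproduct (I : smallType) (D : I -> complex X)
    (Y : complex X) (inj : forall i, chain_map (D i) Y)
    (pr : forall i, chain_map Y (D i)) :
  degreewise_sum inj pr -> is_coproduct inj.
Proof.
move=> dsY Z f; split=> [|u v uf vf].
  have /dchoice[u uP] := fun n => direct_sum_hom (dsY n) (fun i => f i n).
  have uC n x : u n (cdiff Y n x) = cdiff Z n (u (n + 1) x).
    apply: (direct_sum_homP (dsY (n + 1)) (u := u n \o cdiff Y n)
             (v := cdiff Z n \o u (n + 1))) => i y /=.
    by rewrite -cmapP !uP cmapP.
  by exists (ChainMap uC) => i; apply: homotopic_ext => n x /=; apply: uP.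
have /dchoice[s sP] : forall i, homotopic (chain_comp u (inj i)) (chain_comp v (inj i)).
  by move=> i; apply: homotopic_trans (uf i) (homotopic_sym (vf i)).
have /dchoice[t tP] := fun n => direct_sum_hom (dsY n) (fun i => s i n).
exists t => n x.
apply: (direct_sum_homP (dsY (n + 1)) (u := u (n + 1) \- v (n + 1))
  (v := (cdiff Z (n + 1) \o t (n + 1)) \+ (t n \o cdiff Y n))) => i y /=.
by rewrite [LHS](sP i n y) /= tP -cmapP tP.
Qed.

End Homotopy.

Lemma degreewise_sum_ex (R : pzRingType) (X : modClass R) (I : smallType)
    (D : I -> complex (Add X)) :
  exists (Y : complex (Add X)) (inj : forall i, chain_map (D i) Y)
         (pr : forall i, chain_map Y (D i)), degreewise_sum inj pr.
Proof.
have /dchoice[Y /dchoice[inj /dchoice[pr YS]]] :=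
  fun n => direct_sum_ex (fun i => D i n).
have /dchoice[d dP] := fun n =>
  direct_sum_hom (YS (n + 1)) (fun i => inj n i \o cdiff (D i) n).
have dK n x : d n (d (n + 1) x) = 0.
  apply: (direct_sum_homP (YS (n + 1 + 1)) (u := d n \o d (n + 1)) (v := \0)).
  by move=> i y; rewrite /= dP /= dP /= cdiffK linear0.
have YX n : Add X (Y n) by apply: (Add_direct_sum (YS n)) => i; apply: cobjP.
pose Z := Complex YX dK.
have injC i n x : inj n i (cdiff (D i) n x) = cdiff Z n (inj (n + 1) i x).
  by rewrite /= dP.
have prC i n x : pr n i (cdiff Z n x) = cdiff (D i) n (pr (n + 1) i x).
  apply: (direct_sum_homP (YS (n + 1)) (u := pr n i \o d n)
     (v := cdiff (D i) n \o pr (n + 1) i)) => k y /=.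
  rewrite dP /=; case: (YS n) (YS (n + 1)) => prK out _ [prK1 out1 _].
  have [ki|ki] := pselect (k = i); first by subst k; rewrite prK prK1.
  by rewrite out // out1 // linear0.
exists Z, (fun i => @ChainMap _ _ (D i) Z (fun n => inj n i) (injC i)),
  (fun i => @ChainMap _ _ Z (D i) (fun n => pr n i) (prC i)).
exact: YS.
Qed.

Section Stalk.
Variables (R : pzRingType) (X : modClass R).

(** G is S placed in degree n + 1.  The last clause says that a map from S to
    the cycles of degree n + 1 of C extends to a chain map. *)
Definition stalk (S : lmodType R) (n : int) (G : complex (Add X))
    (i : {linear S -> G (n + 1)}) :=
  [/\ bijective i,
      forall m, m <> n + 1 -> forall x : G m, x = 0,
      forall m x, cdiff G m x = 0
    & forall (C : complex (Add X)) (h : {linear S -> C (n + 1)}),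
        (forall x, cdiff C n (h x) = 0) ->
        exists f : chain_map G C, forall x, f (n + 1) (i x) = h x].

(** In degree m, G is the submodule of the x in S with x = 0 or m = n + 1, so
    that its components need no definition by cases on m. *)
Lemma stalk_ex (S : lmodType R) (n : int) :
  Add X S -> exists G i, @stalk S n G i.
Proof.
move=> XS.
have sm m : submodule (fun x : S => x = 0 \/ m = n + 1).
  split; first by left.
  move=> a u v [->|->]; last by right.
  by case=> [->|->]; [left; rewrite scaler0 addr0|right].
have /dchoice[G /dchoice[j jP]] := fun m => submod_ex (sm m).
have jI m : injective (j m) by case: (jP m).
have G0 m : m <> n + 1 -> forall x : G m, x = 0.
  move=> mn x; apply: jI; rewrite linear0.
  by case: (jP m) => _ /(_ (j m x))[_] []//; exists x.
have [i iP] : exists i : {linear S -> G (n + 1)}, forall x, j (n + 1) (i x) = x.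
  apply: (lin_lift_inj (f := idfun) (jI (n + 1))) => x.
  by case: (jP (n + 1)) => _ /(_ x)[+ _]; apply; right.
have iK x : i (j (n + 1) x) = x by apply: jI; rewrite iP.
have GX m : Add X (G m).
  have [mn|mn] := pselect (m = n + 1).
    by rewrite mn; apply: (Add_retract (s := j (n + 1)) (r := i)) XS.
  by apply: (Add_retract (s := j m) (r := \0)) XS => x; rewrite [RHS](G0 m mn).
have dK m (x : G (m + 1 + 1)) :
  (\0 : {linear G (m + 1) -> G m}) ((\0 : {linear _ -> G (m + 1)}) x) = 0 by [].
exists (Complex GX dK), i; split=> //=; first by exists (j (n + 1)).
move=> C h h0.
have /dchoice[f fP] : forall m, exists f : {linear S -> C m},
    (forall e : n + 1 = m, forall x, f x = ecast k (C k) e (h x)) /\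
    (m <> n + 1 -> forall x, f x = 0).
  move=> m; have [mn|mn] := pselect (n + 1 = m).
    subst m; exists h; split=> // e x; by rewrite eq_axiomK.
  by exists \0; split=> // e; case: mn.
have f0 m x : cdiff C m (f (m + 1) x) = 0.
  have [mn|mn] := pselect (m = n).
    subst m; by rewrite ((fP (n + 1)).1 erefl) h0.
  by rewrite (fP (m + 1)).2 ?linear0 // => /addIr.
have fC m (x : G (m + 1)) : (f m \o j m) ((\0 : {linear G (m + 1) -> G m}) x) =
    cdiff C m ((f (m + 1) \o j (m + 1)) x) by rewrite /= !linear0 f0.
exists (@ChainMap _ _ (Complex GX dK) C (fun m => f m \o j m) fC) => x /=.
by rewrite iP ((fP (n + 1)).1 erefl).
Qed.

(** Let Y' be the degreewise direct sum of the D_i.  By the universal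
    properties, Y and Y' are homotopy equivalent through u and v, compatibly
    with the injections.  In Y', a map from G is a finite sum of its components
    on the nose, and these components are detected by the projections of Y'. *)
Lemma stalk_compact (S : lmodType R) (n : int) (G : complex (Add X))
    (i : {linear S -> G (n + 1)}) :
  fin_generated S -> stalk i -> compact G.
Proof.
move=> [l [fS fSS]] [[j iK jK] G0 _ _] I D Y inj cY.
have [Y' [inj' [pr' dsY]]] := degreewise_sum_ex D.
have cY' := degreewise_sum_coproduct dsY.
have [[u uP] _] := cY Y' inj'; have [[v vP] _] := cY' Y inj.
pose idY : chain_map Y Y := @ChainMap _ _ Y Y (fun=> idfun) (fun _ _ => erefl).
have vu : homotopic (chain_comp v u) idY.
  apply: (cY Y inj).2 => k; last exact: homotopic_ext.
  apply: homotopic_trans (vP k).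
  apply: (homotopic_trans (g := chain_comp v (chain_comp u (inj k)))).
    exact: homotopic_ext.
  exact: homotopic_compl.
split=> [f|m e g eI gsum k].
  have Gfg : fin_generated (G (n + 1)).
    by exists l, (i \o fS) => x; have [y yx] := fSS (j x); exists y; rewrite /= yx jK.
  have [s [sU sE]] := direct_sum_fg (dsY (n + 1)) (u (n + 1) \o f (n + 1)) Gfg.
  pose e k : I := tnth (in_tuple s) k.
  pose g k : chain_map G (D (e k)) := chain_comp (pr' (e k)) (chain_comp u f).
  exists (size s), e, g; split.
    exact: (elimT (tuple_uniqP (in_tuple s)) sU).
  have uf m x : sum_map inj' g m x = chain_comp u f m x.
    have [mn|mn] := pselect (m = n + 1); last by rewrite (G0 m mn x) !linear0.
    subst m; rewrite sum_mapE [RHS](sE x) [RHS]big_tnth.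
    by apply: eq_bigr.
  apply: (homotopic_trans (g := sum_map (fun i => chain_comp v (inj' i)) g)).
    by apply: homotopic_sum_map => k; apply: homotopic_sym.
  apply: (homotopic_trans (g := chain_comp v (chain_comp u f))).
    by apply: homotopic_ext => m x; rewrite -chain_comp_sum_map /= uf.
  apply: (homotopic_trans (g := chain_comp (chain_comp v u) f)).
    exact: homotopic_ext.
  apply: (homotopic_trans (g := chain_comp idY f)); last exact: homotopic_ext.
  exact: homotopic_compr.
have usum : null_homotopic (sum_map inj' g).
  apply: (homotopic_trans (g := sum_map (fun i => chain_comp u (inj i)) g)).
    by apply: homotopic_sum_map => q; apply: homotopic_sym.
  apply: (homotopic_trans (g := chain_comp u (sum_map inj g))).
    by apply: homotopic_ext => q x; rewrite chain_comp_sum_map.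
  apply: (homotopic_trans (homotopic_compl u gsum)).
  by apply: homotopic_ext => q x; rewrite /= linear0.
apply: (homotopic_trans (g := chain_comp (pr' (e k)) (sum_map inj' g))).
  apply: homotopic_ext => q x; rewrite /= sum_mapE linear_sum (bigD1 k) //=.
  case: (dsY q) => prK out _; rewrite prK big1 ?addr0 // => t tk.
  by rewrite out // => /eI tk'; rewrite tk' eqxx in tk.
apply: (homotopic_trans (homotopic_compl (pr' (e k)) usum)).
by apply: homotopic_ext => q x; rewrite /= linear0.
Qed.

Lemma stalk_lift (S : lmodType R) (n : int) (G : complex (Add X))
    (i : {linear S -> G (n + 1)}) (C : complex (Add X))
    (h : {linear S -> C (n + 1)}) :
  stalk i -> (forall f : chain_map G C, null_homotopic f) ->
  (forall x, cdiff C n (h x) = 0) ->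
  exists k : {linear S -> C (n + 1 + 1)}, forall x, cdiff C (n + 1) (k x) = h x.
Proof.
move=> [_ _ d0 maps] null /maps[f fP]; have [s sP] := null f.
exists (s (n + 1) \o i) => x /=.
by have := sP n (i x); rewrite /= fP subr0 d0 linear0 addr0.
Qed.

End Stalk.

Lemma pure_acyclic_zero_object (R : pzRingType)
    (C : complex (Add (sub (@flat R)))) :
  finite_left_pure_gldim R -> pure_acyclic (@cdiff _ _ C) -> zero_object C.
Proof.
move=> gR acC.
have ppC n : pure_projective (C n).
  by apply: Add_pure_projective (cobjP C n) => A [].
have [s sP] := pure_acyclic_contraction (@cdiffK _ _ C) acC ppC gR.
exact: contractible_zero_object sP.
Qed.

Theorem mainTheorem6 (R : pzRingType) :
  left_noetherian R -> right_coherent R -> finite_left_pure_gldim R ->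
  K_compactly_generated (Add (sub (@flat R))).
Proof.
move=> nR cR gR; split=> [I D|].
  have [Y [inj [pr dsY]]] := degreewise_sum_ex D.
  by exists Y, inj; apply: degreewise_sum_coproduct dsY.
(* The generators: row spaces S c of matrices c, placed in degree n + 1. *)
have /dchoice[S /dchoice[p /dchoice[j pjP]]] :=
  fun c : {nk : nat * nat & 'M[R]_(nk.1, nk.2)} =>
  image_ex (mulmxr (tagged c) : {linear 'rV[R]_(tag c).1 -> 'rV[R]_(tag c).2}).
have subS c : sub (@flat R) (S c).
  by case: (pjP c) => pS jI _; apply: sub_flat_image nR pS jI.
have /dchoice[G /dchoice[i GP]] := fun cn : {nk : nat * nat & 'M[R]_(nk.1, nk.2)} * int =>
  stalk_ex cn.2 (Add_in (subS cn.1)).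
exists ({nk : nat * nat & 'M[R]_(nk.1, nk.2)} * int)%type, G; split=> [cn|C nullC].
  apply: stalk_compact (GP cn).
  by case: (subS cn.1) => -[m [n [g [f [fS _]]]]] _; exists n, f.
apply: pure_acyclic_zero_object => // n F h Ffp dh.
have [a [b [c refl]]] := sub_flat_reflection nR cR Ffp.
pose t : {nk : nat * nat & 'M[R]_(nk.1, nk.2)} :=
  Tagged (fun nk : nat * nat => 'M[R]_(nk.1, nk.2))
    (lin1_mx c : 'M[R]_((a, b).1, (a, b).2)).
case: (pjP t) => pS jI jpE.
have [v|q qS qP] := refl (S t) (p t) (j t) pS jI; first by rewrite jpE /= mul_rV_lin1.
have [h' h'E] := qP _ h (cobjP C (n + 1)).
have [x|k kP] := stalk_lift (h := h') (GP (t, n)) (nullC (t, n)).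
  by have [y <-] := qS x; rewrite h'E.
by exists (k \o q) => x; rewrite /= kP h'E.
Qed.
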